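(* Any two connected, cospectral digraphs of rank $4$ with exactly one negative eigenvalue are switching equivalent.
   Context: A digraph $D=(V,E)$ is finite with arc set $E\subseteq V\times V$ and no loops; both $(u,v)$ and $(v,u)$ may belong to $E$, in which case $\{u,v\}$ is called a digon. $D$ is connected if its underlying undirected graph is connected. The Hermitian adjacency matrix $H=H(D)$ has entries $h_{uv}=1$ if $(u,v)\in E$ and $(v,u)\in E$; $h_{uv}=i$ if $(u,v)\in E$ and $(v,u)\notin E$; $h_{uv}=-i$ if $(u,v)\notin E$ and $(v,u)\in E$; and $h_{uv}=0$ otherwise. The rank, eigenvalues and spectrum (multiset of eigenvalues) of $D$ are those of $H(D)$; eigenvalues are counted with multiplicity. Two digraphs are cospectral if their spectra coincide. A four-way switching is the operation of changing a digraph $D$ into a digraph $D'$ by choosing a diagonal matrix $S$ with $S_{jj}\in\{\pm1,\pm i\}$ such that $S^{-1}H(D)S$ is again the Hermitian adjacency matrix of a digraph, and setting $H(D')=S^{-1}H(D)S$. Two digraphs $D$ and $D'$ are switching equivalent if $D'$ may be obtained (up to isomorphism) from $D$ by a four-way switching, possibly followed by a reversal of all arcs. *)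

(* Defs.v *)
From HB Require Import structures.
From mathcomp Require Import all_boot all_order all_algebra.

Set Implicit Arguments.
Unset Strict Implicit.
Unset Printing Implicit Defensive.

Import Order.TTheory GRing.Theory Num.Theory.
Local Open Scope ring_scope.

Record digraph (V : finType) := Digraph {
  arc :> rel V;
  arc_irr : irreflexive arc
}.

Definition connected (V : finType) (D : digraph V) : Prop :=
  forall x y : V, connect (fun u v => D u v || D v u) x y.

Definition isomorphic (V W : finType) (D : digraph V) (D' : digraph W) : Prop :=
  exists2 f : V -> W, bijective f & forall x y, D' (f x) (f y) = D x y.

Lemma reversal_subproof (V : finType) (D : digraph V) :
  irreflexive (fun x y => D y x).
Proof. by move=> x; apply: arc_irr. Qed.

Definition reversal (V : finType) (D : digraph V) : digraph V :=
  Digraph (reversal_subproof D).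

(* The role of the complex field is played by an arbitrary [C : numClosedFieldType] (for instance
   [algC], or [R[i]] for a real closed field [R]); in the partial order of [C],
   [z < 0] means that [z] is real and negative. *)
Section Hermitian.
Variable C : numClosedFieldType.

Definition herm_entry (V : finType) (D : digraph V) (u v : V) : C :=
  if D u v then (if D v u then 1 else 'i)
  else (if D v u then - 'i else 0).

(* Rows and columns follow the enumeration of [V]. *)
Definition herm_adj (V : finType) (D : digraph V) : 'M[C]_#|V| :=
  \matrix_(i, j) herm_entry D (enum_val i) (enum_val j).

(* The roots of the characteristic polynomial, repeated according to
   multiplicity; only meaningful up to [perm_eq]. *)
Definition eigenvalues (n : nat) (A : 'M[C]_n) : seq C :=
  sval (closed_field_poly_normal (char_poly A)).

Lemma eigenvaluesE (n : nat) (A : 'M[C]_n) :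
  char_poly A = \prod_(z <- eigenvalues A) ('X - z%:P).
Proof.
rewrite /eigenvalues; case: closed_field_poly_normal => r /= {1}->.
by rewrite (monicP (char_poly_monic A)) scale1r.
Qed.

Definition spectrum (V : finType) (D : digraph V) : seq C :=
  eigenvalues (herm_adj D).

Definition cospectral (V W : finType) (D : digraph V) (D' : digraph W) : bool :=
  perm_eq (spectrum D) (spectrum D').

Definition four_way_switching (V : finType) (D D' : digraph V) : Prop :=
  exists S : 'M[C]_#|V|,
    [/\ is_diag_mx S,
        forall j, S j j \in [:: 1; -1; 'i; - 'i]
      & herm_adj D' = invmx S *m herm_adj D *m S].

Definition switching_equivalent (V W : finType)
    (D : digraph V) (D' : digraph W) : Prop :=
  exists2 D1 : digraph V, four_way_switching D D1
    & isomorphic D1 D' \/ isomorphic (reversal D1) D'.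

End Hermitian.

Arguments herm_adj C {V} D.
Arguments spectrum C {V} D.
Arguments cospectral C {V W} D D'.
Arguments four_way_switching C {V} D D'.
Arguments switching_equivalent C {V W} D D'.

(* Main.v *)
Require Import Defs.
From HB Require Import structures.
From mathcomp Require Import all_boot all_order all_algebra.
From mathcomp Require Import spectral ring.

Set Implicit Arguments.
Unset Strict Implicit.
Unset Printing Implicit Defensive.

Import Order.TTheory GRing.Theory Num.Theory.
Local Open Scope ring_scope.

(** Why the theorem holds.  Let [H] be the Hermitian adjacency matrix of a
    connected digraph of rank 4 with one negative eigenvalue, and read [H] as
    the Gram matrix of the unit vectors [e_i] for the Hermitian form
    [x H y^*].  This form is Lorentzian modulo its radical, and every [e_i] is
    isotropic because [H] has zero diagonal.

    If [u] and [v] are adjacent, [e_u] and [e_v] span a hyperbolic plane,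
    which contains a negative vector; hence the form is nonnegative on the
    orthogonal complement of that plane, and an isotropic vector of the
    complement lies in the radical.  Projecting a third [e_w] to this
    complement gives, in one stroke ([hyperbolic_projection]), a sign
    condition on the triangle [u, v, w] and, in the case of equality, a linear
    relation between rows [u], [v] and [w] of [H].  The consequences are:

    - two nonadjacent vertices have proportional rows
      ([nonadjacent_row]), so that nonadjacency is an equivalence relation and
      the underlying graph is complete multipartite;
    - the product of the entries of [H] around a triangle cannot be 1 by the
      sign condition, and it cannot be [+-i], because all rows would then be
      combinations of two of them, against the rank; so it is -1
      ([triangle_gain]);
    - therefore a diagonal matrix of fourth roots of unity conjugates [H] into
      [- A], where [A] is the 0-1 adjacency matrix of the complete multipartite
      graph ([canonical_form]).

    It remains to recover the part sizes from the spectrum.  Write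
    [- A = N - J], where [N] is the matrix of the nonadjacency relation and
    [J] the all-ones matrix.  The spectrum determines the traces of the powers
    of [N - J], and such a trace of exponent [m + 1] is [- m] times the
    moment [p_m = sum_i c_i ^ m], plus a polynomial in the lower moments, where
    [c_i] is the size of the part of [i].  By induction cospectral digraphs
    have equal moments ([moments_of_traces]), hence as many vertices in
    parts of each size ([count_of_moments]), hence a bijection between their
    vertices that maps parts onto parts ([equivalence_bijection]).  Along this
    bijection both Hermitian matrices are conjugate to the same matrix
    [N - J] by diagonal matrices, and the quotient of these diagonal matrices
    is the required switching. *)

(** * Eigenvalues of Hermitian matrices *)

Lemma char_poly_conj (F : fieldType) (n : nat) (P A : 'M[F]_n) :
  P \in unitmx -> char_poly (invmx P *m A *m P) = char_poly A.
Proof.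
move=> Pu; rewrite /char_poly /char_poly_mx.
pose Q := map_mx polyC P; pose Q' := map_mx polyC (invmx P).
have Q'Q : Q' *m Q = 1%:M by rewrite -map_mxM mulVmx // map_mx1.
have -> : 'X%:M - map_mx polyC (invmx P *m A *m P) =
          Q' *m ('X%:M - map_mx polyC A) *m Q.
  by rewrite mulmxBr mulmxBl !map_mxM mul_mx_scalar -scalemxAl Q'Q scalemx1.
by rewrite !det_mulmx mulrAC -det_mulmx Q'Q det1 mul1r.
Qed.

Lemma conj_expr (R : comUnitRingType) (n : nat) (P A : 'M[R]_n) (r : nat) :
  P \in unitmx -> (invmx P *m A *m P) ^+ r = invmx P *m A ^+ r *m P.
Proof.
move=> Pu; elim: r => [|r IHr]; first by rewrite !expr0 mulmx1 mulVmx.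
rewrite !exprSr IHr -!mulmxE !mulmxA.
by rewrite -[_ *m P *m invmx P]mulmxA mulmxV // mulmx1.
Qed.

Lemma diag_expr (R : comUnitRingType) (n : nat) (d : 'rV[R]_n) (r : nat) :
  diag_mx d ^+ r = diag_mx (\row_i d 0 i ^+ r).
Proof.
elim: r => [|r IHr].
  rewrite expr0; apply/matrixP=> i j; rewrite !mxE expr0.
  by case: eqP.
rewrite exprS IHr -mulmxE mul_diag_mx; apply/matrixP=> i j.
by rewrite !mxE mulrnAr exprS.
Qed.

Section Spectral.
Variable C : numClosedFieldType.

Lemma eigenvalues_conj_diag (n : nat) (P : 'M[C]_n) (d : 'rV[C]_n) :
  P \in unitmx ->
  perm_eq (eigenvalues (invmx P *m diag_mx d *m P)) [seq d 0 i | i : 'I_n].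
Proof.
move=> Pu; apply: prod_XsubC_eq; rewrite -eigenvaluesE char_poly_conj //.
rewrite char_poly_trig ?diag_mx_is_trig // big_map big_enum.
by apply: eq_bigr => i _; rewrite mxE eqxx.
Qed.

Lemma trace_expr (n : nat) (A : 'M[C]_n) (r : nat) : A \is normalmx ->
  \tr (A ^+ r) = \sum_(z <- eigenvalues A) z ^+ r.
Proof.
move=> /orthomx_spectralP; have := spectral_unit A.
move: (spectralmx A) (spectral_diag A) => P d Pu ->.
rewrite (perm_big _ (eigenvalues_conj_diag d Pu)) big_map big_enum /=.
rewrite conj_expr // mxtrace_mulC mulmxA mulmxV // mul1mx diag_expr.
by rewrite mxtrace_diag; apply: eq_bigr => i _; rewrite mxE.
Qed.

Local Open Scope sesquilinear_scope.

(** * The Hermitian form of a matrix with one negative eigenvalue *)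

Definition hform (n : nat) (H : 'M[C]_n) (x y : 'rV[C]_n) : C :=
  (x *m H *m y^t* ) 0 0.

Lemma hermitian_hermsymmx (n : nat) (H : 'M[C]_n) :
  H^t* = H -> H \is hermsymmx.
Proof. by move=> herm; apply/is_hermitianmxP; rewrite expr0 scale1r herm. Qed.

(** In an orthonormal eigenbasis the form is [sum_i d_i |x_i|^2], and [p] reads
    off the coordinate along the only negative [d_i]: the remaining terms are
    nonnegative. *)
Lemma one_negative_form (n : nat) (H : 'M[C]_n) :
  H^t* = H -> count (fun z : C => z < 0) (eigenvalues H) = 1%N ->
  exists p : 'cV[C]_n, forall x : 'rV[C]_n,
    (x *m p) 0 0 = 0 -> 0 <= hform H x x.
Proof.
move=> /hermitian_hermsymmx hermH.
have := hermitian_spectral_diag_real hermH.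
have := spectral_unitarymx H.
have /orthomx_spectralP := hermitian_normalmx hermH.
move: (spectralmx H) (spectral_diag H) => P d eqH Punit dreal.
rewrite eqH; have /permP-> := eigenvalues_conj_diag d (unitarymx_unit Punit).
rewrite count_map -size_filter.
case negE: filter => [//|i0 [|//]] _.
exists (col i0 (P^t*)) => x; rewrite colE mulmxA -colE => xp.
have {xp} xi0 : (x *m P^t* ) 0 i0 = 0 by rewrite -xp [RHS]mxE.
rewrite /hform invmx_unitary // !mulmxA.
set u := x *m P^t* in xi0 *.
have -> : u *m diag_mx d *m P *m x^t* = u *m diag_mx d *m u^t*.
  by rewrite /u trmx_mul map_mxM map_trmx trmxK map_mxCK !mulmxA.
move: u xi0 => u xi0.
rewrite mul_mx_diag mxE; apply: sumr_ge0 => i _; rewrite !mxE.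
have [-> | ne_i] := eqVneq i i0; first by rewrite xi0 !mul0r.
rewrite mulrAC mulr_ge0 ?mul_conjC_ge0 //.
have: i \notin [seq x <- enum 'I_n | (d 0 x < 0)] by rewrite negE inE.
rewrite mem_filter mem_enum andbT real_ltNge ?real0 ?negbK //.
exact/mxOverP.
Qed.

Section Form.
Variables (n : nat) (H : 'M[C]_n).
Hypothesis herm : H^t* = H.
Local Notation h := (hform H).
Implicit Types x y z : 'rV[C]_n.

Lemma hformDl x y z : h (x + y) z = h x z + h y z.
Proof. by rewrite /hform !mulmxDl mxE. Qed.

Lemma hformZl a x z : h (a *: x) z = a * h x z.
Proof. by rewrite /hform -!scalemxAl mxE. Qed.

Lemma hformC x y : h y x = (h x y)^*.
Proof.
transitivity (((x *m H *m y^t* )^t* ) 0 0); last first.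
  by rewrite mxE [X in X^*]mxE.
by rewrite !trmx_mul !map_mxM map_trmx herm trmxK map_mxCK mulmxA.
Qed.

Lemma hformDr x y z : h z (x + y) = h z x + h z y.
Proof. by rewrite hformC hformDl rmorphD /= -!hformC. Qed.

Lemma hformZr a x z : h z (a *: x) = a^* * h z x.
Proof. by rewrite hformC hformZl rmorphM /= -!hformC. Qed.

Lemma hform_delta x j : h x (delta_mx 0 j) = (x *m H) 0 j.
Proof. by rewrite /hform trmx_delta map_delta_mx -colE mxE. Qed.

Lemma hform_ker x : (forall z, h x z = 0) -> x *m H = 0.
Proof. by move=> x0; apply/rowP=> j; rewrite -hform_delta x0 mxE. Qed.

Hypothesis neg1 : count (fun z : C => z < 0) (eigenvalues H) = 1%N.

(** Otherwise [x] and [y] would span a plane that contains no nonnegative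
    vector except 0, while every plane meets the hyperplane of
    [one_negative_form]. *)
Lemma orth_negative_ge0 x y : h x x < 0 -> h y x = 0 -> 0 <= h y y.
Proof.
move=> xneg yx0; have [p p_ge0] := one_negative_form herm neg1.
pose cx : C := (x *m p) 0 0; pose cy : C := (y *m p) 0 0.
have xy0 : h x y = 0 by rewrite hformC yx0 rmorph0.
have cx_neq0 : cx != 0.
  by apply: contraTneq xneg => /p_ge0 /le_gtF->.
(* the combination of [x] and [y] that lies in the hyperplane of [p] *)
have /p_ge0: ((cx *: y + (- cy) *: x) *m p) 0 0 = 0.
  rewrite mulmxDl -!scalemxAl mxE [X in X + _]mxE [X in _ + X]mxE.
  by rewrite -/cx -/cy; ring.
rewrite !(hformDl, hformDr, hformZl, hformZr) yx0 xy0 !mulr0 addr0 add0r.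
rewrite !mulrA -!normCK normrN => sum_ge0.
rewrite -(pmulr_rge0 _ (_ : 0 < `|cx| ^+ 2)) ?exprn_gt0 ?normr_gt0 //.
apply: le_trans (_ : - (`|cy| ^+ 2 * h x x) <= _).
  by rewrite oppr_ge0 mulr_ge0_le0 ?exprn_ge0 // ltW.
by rewrite -subr_ge0 opprK.
Qed.

(** The form is positive semidefinite on the orthogonal complement of [x], and
    there an isotropic vector is orthogonal to everything by the usual
    Cauchy-Schwarz argument. *)
Lemma orth_negative_ker x y : h x x < 0 -> h y x = 0 -> h y y = 0 ->
  y *m H = 0.
Proof.
move=> xneg yx0 yy0; apply: hform_ker => z.
have xy0 : h x y = 0 by rewrite hformC yx0 rmorph0.
have xx_neq0 : h x x != 0 by rewrite lt_eqF.
pose w := z - (h z x / h x x) *: x.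
have wx0 : h w x = 0.
  by rewrite /w -scaleNr hformDl hformZl mulNr divfK ?subrr.
have -> : h y z = h y w.
  by rewrite /w -scaleNr hformDr hformZr yx0 mulr0 addr0.
apply/eqP/negPn/negP => yw_neq0.
have ww_ge0 := orth_negative_ge0 xneg wx0.
move: w wx0 yw_neq0 ww_ge0 => w wx0 yw_neq0 ww_ge0.
(* [s] is such that [h] takes the value -1 at [w - s (h y w)^* y] *)
pose s := (h w w + 1) / (2 * `|h y w| ^+ 2).
have s_real : s^* = s.
  apply/CrealP/ger0_real; rewrite divr_ge0 ?addr_ge0 ?ler01 //.
  by rewrite mulr_ge0 ?exprn_ge0.
pose c := - (s * (h y w)^* ).
have /(orth_negative_ge0 xneg) : h (w + c *: y) x = 0.
  by rewrite hformDl hformZl wx0 yx0 mulr0 addr0.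
rewrite !(hformDl, hformDr, hformZl, hformZr) yy0 !mulr0 addr0.
rewrite [h w y]hformC /c rmorphN rmorphM /= conjCK s_real.
have -> : h w w + - (s * h y w) * (h y w)^* + - (s * (h y w)^* ) * h y w =
          h w w - s * (2 * `|h y w| ^+ 2) by rewrite normCK; ring.
rewrite divfK ?mulf_neq0 ?pnatr_eq0 ?expf_neq0 ?normr_eq0 //.
by rewrite opprD addNKr oppr_ge0 ler10.
Qed.
End Form.

(** The sum of two fourth roots of unity has modulus 0, 2 or the square root
    of 2. *)
Lemma sum_fourth_roots (p q r : C) :
  p ^+ 4 = 1 -> q ^+ 4 = 1 -> r ^+ 4 = 1 -> p <> q + r.
Proof.
move=> p4 q4 r4 eq_p.
have /eqP : (q ^+ 2 - r ^+ 2) * (q ^+ 2 + r ^+ 2) = 0.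
  by transitivity (q ^+ 4 - r ^+ 4); [ring | rewrite q4 r4 subrr].
rewrite mulf_eq0 subr_eq0 addr_eq0 => /orP[] /eqP q2.
  have t2 : (q ^+ 3 * r) ^+ 2 = 1.
    transitivity (q ^+ 4 * (q ^+ 2 * r ^+ 2)); first by ring.
    by rewrite -q2 -exprD q4 mulr1.
  have t8 : 8 * (q ^+ 3 * r) = -7.
    transitivity (p ^+ 4 - 8 * q ^+ 4); last by rewrite p4 q4; ring.
    rewrite eq_p; apply/eqP; rewrite -subr_eq0.
    have -> : 8 * (q ^+ 3 * r) - ((q + r) ^+ 4 - 8 * q ^+ 4) =
        (q ^+ 2 - r ^+ 2) * (r ^+ 2 + 7 * q ^+ 2 + 4 * q * r) by ring.
    by rewrite q2 subrr mul0r.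
  have /eqP : (8 * (q ^+ 3 * r)) ^+ 2 = (-7) ^+ 2 by rewrite t8.
  by rewrite exprMn t2 mulr1 sqrrN -!natrX eqr_nat.
have /eqP : p ^+ 4 = -4.
  have -> : p ^+ 4 = (q ^+ 2 + r ^+ 2 + 2 * q * r) ^+ 2 by rewrite eq_p; ring.
  rewrite q2 addNr add0r.
  transitivity (4 * q ^+ 2 * r ^+ 2); first by ring.
  rewrite q2; transitivity (- 4 * r ^+ 4); first by ring.
  by rewrite r4 mulr1.
by rewrite p4 -subr_eq0 opprK -(natrD _ 1 4) pnatr_eq0.
Qed.

Lemma fourth_root_conj (z : C) : z ^+ 4 = 1 -> z * z^* = 1.
Proof.
move=> z4; rewrite -normCK; have: `|z| ^+ 4 = 1 by rewrite -normrX z4 normr1.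
by move/eqP; rewrite pexpr_eq1 // => /eqP->; rewrite expr1n.
Qed.

(** * Complete multipartite structure and triangle gains *)

Section Lorentzian.
Variables (n : nat) (H : 'M[C]_n).
Hypothesis herm : H^t* = H.
Hypothesis neg1 : count (fun z : C => z < 0) (eigenvalues H) = 1%N.
Hypothesis H_diag : forall i, H i i = 0.
Hypothesis H_unit : forall i j, H i j != 0 -> H i j ^+ 4 = 1.

Lemma hermE i j : H j i = (H i j)^*.
Proof. by rewrite -[in LHS]herm !mxE. Qed.

Lemma H_sym i j : (H j i == 0) = (H i j == 0).
Proof. by rewrite hermE conjC_eq0. Qed.

Lemma H_mul_conj i j : H i j != 0 -> H i j * H j i = 1.
Proof. by move=> /H_unit/fourth_root_conj; rewrite [H j i]hermE. Qed.

(** The vector [y = e_w - alpha e_u - beta e_v] is the projection of [e_w]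
    to the complement of the hyperbolic plane of [e_u] and [e_v], and
    [x = e_u - h_uv e_v] is a negative vector of this plane.  The expression
    whose sign is asserted is the opposite of the value of the form at [y]; as
    [beta * H v w] is conjugate to [alpha * H u w], it is twice the real part
    of the product of the entries around the triangle. *)
Lemma hyperbolic_projection u v w :
  H u v != 0 ->
  let alpha := H w v * H v u in
  let beta := H w u * H u v in
  alpha * H u w + beta * H v w <= 0 /\
  (alpha * H u w + beta * H v w = 0 ->
   forall z, H w z = alpha * H u z + beta * H v z).
Proof.
move=> uv_adj alpha beta.
have uvu := H_mul_conj uv_adj.
pose e i : 'rV[C]_n := delta_mx 0 i.
pose x := e u - H u v *: e v.
pose y := e w - alpha *: e u - beta *: e v.
have yH j : (y *m H) 0 j = H w j - alpha * H u j - beta * H v j.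
  by rewrite /y !mulmxBl -!scalemxAl -!rowE !mxE.
have yu0 : (y *m H) 0 u = 0.
  by rewrite yH H_diag /beta -[_ * H u v * _]mulrA uvu; ring.
have yv0 : (y *m H) 0 v = 0.
  by rewrite yH H_diag /alpha -[_ * H v u * _]mulrA (mulrC (H v u)) uvu; ring.
have yx0 : hform H y x = 0.
  rewrite /x -scaleNr hformDr // hformZr // !hform_delta // yu0 yv0.
  by rewrite mulr0 addr0.
have yy : hform H y y = - (alpha * H u w + beta * H v w).
  rewrite {2}/y -!scaleNr !(hformDr herm, hformZr herm) !hform_delta //.
  by rewrite yu0 yv0 yH H_diag; ring.
have xx : hform H x x < 0.
  have -> : hform H x x = - 2.
    rewrite {2}/x -scaleNr hformDr // hformZr // !hform_delta //.
    rewrite /x mulmxBl -scalemxAl -!rowE !mxE !H_diag rmorphN /= -hermE.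
    transitivity (- (2 * (H u v * H v u))); first by ring.
    by rewrite uvu mulr1.
  by rewrite oppr_lt0 ltr0n.
split; first by rewrite -oppr_ge0 -yy; apply: orth_negative_ge0 xx yx0.
move=> T0 z; apply/eqP; rewrite -subr_eq0 opprD addrA -yH.
by rewrite (orth_negative_ker herm neg1 xx yx0) ?mxE // yy T0 oppr0.
Qed.

(** When [w] and [u] are nonadjacent the projection of [e_w] is isotropic, hence
    in the radical. *)
Lemma nonadjacent_row u v w z :
  H u v != 0 -> H w u = 0 -> H w z = H w v * H v u * H u z.
Proof.
move=> uv_adj wu0; have uw0 : H u w = 0 by apply/eqP; rewrite H_sym wu0.
have [_] := hyperbolic_projection w uv_adj.
by rewrite wu0 uw0 !mulr0 !mul0r addr0 => /(_ erefl)->; rewrite mul0r addr0.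
Qed.

Hypothesis H_row : forall i, exists j, H i j != 0.

(** This makes nonadjacency transitive: nonadjacent vertices have proportional
    nonzero rows, so the same neighbours. *)
Lemma nonadjacent_eq0 u w z : H w u = 0 -> (H w z == 0) = (H u z == 0).
Proof.
move=> wu0; have [v uv_adj] := H_row u; have [v' wv'_adj] := H_row w.
have wz := nonadjacent_row _ uv_adj wu0.
move: (wv'_adj); rewrite (wz v') mulf_eq0 negb_or => /andP[wvu _].
by rewrite wz mulf_eq0 (negPf wvu).
Qed.

Hypothesis H_rank : (2 < \rank H)%N.

(** The product [t] around the triangle is a fourth root of unity of nonpositive
    real part, so only [t = +-i] must be excluded.  In that case row [w] is
    [a] times row [u] plus [b] times row [v], with fourth roots of unity [a]
    and [b]; by [sum_fourth_roots] no vertex can be adjacent to all of [u], [v]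
    and [w], so each row is proportional to one of these three, and the rank is
    at most 2. *)
Lemma triangle_gain u v w : H u v != 0 -> H v w != 0 -> H u w != 0 ->
  H w v * H v u * H u w = -1.
Proof.
move=> uv_adj vw_adj uw_adj.
have [] := hyperbolic_projection w uv_adj.
set a := H w v * H v u; set b := H w u * H u v => le0 rowE0.
have wv4 : H w v ^+ 4 = 1 by apply: H_unit; rewrite H_sym.
have vu4 : H v u ^+ 4 = 1 by apply: H_unit; rewrite H_sym.
have wu4 : H w u ^+ 4 = 1 by apply: H_unit; rewrite H_sym.
have a4 : a ^+ 4 = 1 by rewrite exprMn wv4 vu4 mulr1.
have b4 : b ^+ 4 = 1 by rewrite exprMn wu4 H_unit ?mulr1.
have ne0 : a * H u w + b * H v w != 0.
  apply/eqP=> /rowE0 wrow.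
  have span z : exists c d, forall j, H z j = c * H u j + d * H v j.
    have [zu | zu] := eqVneq (H z u) 0.
      exists (H z v * H v u), 0 => j.
      by rewrite (nonadjacent_row j uv_adj zu); ring.
    have [zv | zv] := eqVneq (H z v) 0.
      exists 0, (H z w * H w v) => j.
      by rewrite (nonadjacent_row j vw_adj zv); ring.
    have [zw | zw] := eqVneq (H z w) 0.
      have wu_adj : H w u != 0 by rewrite H_sym.
      exists (H z u * H u w * a), (H z u * H u w * b) => j.
      by rewrite (nonadjacent_row j wu_adj zw) wrow; ring.
    have wz4 : H w z ^+ 4 = 1 by apply: H_unit; rewrite H_sym.
    case: (sum_fourth_roots wz4 _ _ (wrow z)).
      by rewrite exprMn a4 mul1r H_unit // H_sym.
    by rewrite exprMn b4 mul1r H_unit // H_sym.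
  have: (H <= col_mx (row u H) (row v H))%MS.
    apply/row_subP => z; have [c [d zrow]] := span z.
    have -> : row z H = c *: row u H + d *: row v H.
      by apply/rowP => j; rewrite !mxE zrow.
    rewrite addmx_sub // scalemx_sub //; apply/submxP.
      by exists (row_mx 1 0); rewrite mul_row_col mul1mx mul0mx addr0.
    by exists (row_mx 0 1); rewrite mul_row_col mul1mx mul0mx add0r.
  move/mxrankS; rewrite leqNgt (leq_ltn_trans _ H_rank) //.
  exact: rank_leq_row.
have bE : b * H v w = (a * H u w)^*.
  by rewrite /a /b !rmorphM /= -!hermE; ring.
move: ne0 le0; rewrite {}bE {rowE0}.
have: (a * H u w) ^+ 4 = 1 by rewrite exprMn a4 H_unit ?mulr1.
move: (a * H u w) => t t4 ne0 le0.
have tt := fourth_root_conj t4.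
have /eqP : (t - 1) * (t + 1) * (t ^+ 2 + 1) = 0.
  by transitivity (t ^+ 4 - 1); [ring | rewrite t4 subrr].
rewrite !mulf_eq0 subr_eq0 addr_eq0 => /orP[/orP[] /eqP t1|]; last 1 first.
- rewrite addr_eq0 => /eqP t2; case/eqP: ne0.
  apply: (@mulfI _ t).
    by apply: contra_eqN t4 => /eqP->; rewrite expr0n eq_sym oner_eq0.
  by rewrite mulrDr tt -expr2 t2 mulr0 addNr.
- by move: le0; rewrite t1 rmorph1 -(natrD _ 1 1) lern0.
- exact: t1.
Qed.

(** Fix a base vertex [u] and a neighbour [v] of it.  Normalising the entries
    of row [u] forces [s i = H u i] for [i] adjacent to [u], and the triangle
    condition then gives every entry between neighbours of [u].  A vertex [i]
    nonadjacent to [u] has row [H i v * H v u] times row [u], and [s i] is the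
    opposite of the conjugate of this factor. *)
Lemma canonical_form : exists s : 'I_n -> C,
  (forall i, s i ^+ 4 = 1) /\
  forall i j, H i j = - (s i)^* * (H i j != 0)%:R * s j.
Proof.
have n_gt0 : (0 < n)%N.
  by apply: leq_trans (rank_leq_row H); apply: ltnW (ltnW _).
pose u := Ordinal n_gt0; have [v uv_adj] := H_row u.
have vu_adj : H v u != 0 by rewrite H_sym.
pose s i := if H i u == 0 then - (H u v * H v i) else H u i.
have far i : H i u = 0 -> H i v != 0.
  by move=> iu; rewrite (nonadjacent_eq0 _ iu).
exists s; split=> [i | i j].
  rewrite /s; case: eqP => [iu | /eqP iu].
    have -> : (- (H u v * H v i)) ^+ 4 = H u v ^+ 4 * H v i ^+ 4 by ring.
    by rewrite !H_unit ?mulr1 // H_sym far.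
  by rewrite H_unit // H_sym.
have [ij0 | ij] := eqVneq (H i j) 0; first by rewrite mulr0 mul0r.
rewrite mulr1 /s; case: eqP => [iu | /eqP iu].
  rewrite -H_sym in ij.
  case: eqP => [ju | /eqP ju].
    by move: ij; rewrite (nonadjacent_eq0 i ju) -H_sym iu eqxx.
  rewrite rmorphN opprK rmorphM /= -!hermE.
  by rewrite (nonadjacent_row j uv_adj iu); ring.
case: eqP => [ju | /eqP ju].
  rewrite -hermE [LHS]hermE (nonadjacent_row i uv_adj ju) !rmorphM /= -!hermE.
  ring.
rewrite -hermE.
have := triangle_gain (_ : H u j != 0) (_ : H j i != 0) (_ : H u i != 0).
rewrite ![H _ i == 0]H_sym (H_sym j u) => /(_ ju ij iu) gain.
transitivity (H i j * (H j u * H u j) * (H u i * H i u)).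
  by rewrite !H_mul_conj ?mulr1 // H_sym.
transitivity ((H i j * H j u * H u i) * H u j * H i u); first by ring.
by rewrite gain; ring.
Qed.

End Lorentzian.
End Spectral.

(** * Traces of powers and the moments of the class sizes *)

Definition eclass (X : finType) (e : rel X) (x : X) := [set y | e x y].

Section Moments.
Variables (R : numDomainType) (n : nat) (e : rel 'I_n).
Hypothesis eqv_e : equivalence_rel e.

Definition class_size i := #|eclass e i|.
Definition moment a : R := \sum_i (class_size i)%:R ^+ a.

Local Notation N := (\matrix_(i, j) (e i j)%:R : 'M[R]_n).
Local Notation M := (N - const_mx 1).
Local Notation ones := (const_mx 1 : 'cV[R]_n).

(** Replacing the factors [M = N - J] by [N] one at a time, through
    [J = ones * ones^T], turns traces of powers of [M] into moments; these two
    families are what appears on the way. *)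
Definition mixed_sum b a : R := (ones^T *m N ^+ a *m M ^+ b *m ones) 0 0.
Definition mixed_trace b a : R := \tr (M ^+ b *m N ^+ a).

Lemma class_size_eq i j : e i j -> class_size i = class_size j.
Proof.
move=> eij; apply: eq_card => k; rewrite !inE.
by have [_ ->] := eqv_e i j k.
Qed.

Lemma sum_class (F : 'I_n -> R) i :
  (forall j, e i j -> F j = F i) ->
  \sum_j (e i j)%:R * F j = (class_size i)%:R * F i.
Proof.
move=> Fi; rewrite /class_size -sum1_card natr_sum mulr_suml.
rewrite [RHS]big_mkcond; apply: eq_bigr => j _; rewrite inE.
by case: ifP => [/Fi-> | _]; rewrite ?mul0r.
Qed.

Lemma N_expr a i j : (N ^+ a.+1) i j = (class_size i)%:R ^+ a * (e i j)%:R.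
Proof.
elim: a i j => [|a IHa] i j; first by rewrite expr1 !mxE mul1r.
rewrite exprS -mulmxE mxE.
under eq_bigr => k _ do rewrite IHa mxE.
rewrite sum_class ?mulrA -?exprS // => k eik.
rewrite (class_size_eq eik); congr (_ * _%:R).
by have [_ ->] := eqv_e i k j.
Qed.

Lemma N_expr_ones a : N ^+ a *m ones = \col_i (class_size i)%:R ^+ a.
Proof.
case: a => [|a]; first by rewrite mul1mx; apply/colP => i; rewrite !mxE.
apply/colP => i; rewrite !mxE.
under eq_bigr => k _ do rewrite N_expr mxE -mulrA.
rewrite -mulr_sumr sum_class ?mulr1 // mulrC exprS //.
Qed.

Lemma mixed_sum0 a : mixed_sum 0 a = moment a.
Proof.
rewrite /mixed_sum expr0 mulmx1 -mulmxA N_expr_ones mxE.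
by apply: eq_bigr => i _; rewrite !mxE mul1r.
Qed.

Lemma ones_mul_tr : (const_mx 1 : 'M[R]_n) = ones *m ones^T.
Proof. by apply/matrixP => i j; rewrite !mxE big_ord1 !mxE mulr1. Qed.

Lemma mul_ones_mul (A : 'rV[R]_n) (B : 'cV[R]_n) :
  (A *m const_mx 1 *m B) 0 0 = (A *m ones) 0 0 * (ones^T *m B) 0 0.
Proof.
by rewrite ones_mul_tr mulmxA -(mulmxA (A *m ones)) mxE big_ord1.
Qed.

Lemma mixed_sumS b a :
  mixed_sum b.+1 a = mixed_sum b a.+1 - moment a * mixed_sum b 0.
Proof.
rewrite -mixed_sum0 /mixed_sum (exprS _ b) (exprSr _ a) -!mulmxE !expr0 !mulmx1.
have -> (A : 'rV[R]_n) : A *m (M *m M ^+ b) *m ones =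
    A *m N *m M ^+ b *m ones - A *m const_mx 1 *m (M ^+ b *m ones).
  by rewrite !mulmxA mulmxBr !mulmxBl.
by rewrite mxE [X in _ + X]mxE mul_ones_mul !mulmxA.
Qed.

Lemma mixed_trace0 a : mixed_trace 0 a.+1 = moment a.
Proof.
rewrite /mixed_trace expr0 mul1mx; apply: eq_bigr => i _.
rewrite N_expr; have [-> _] := eqv_e i i i; exact: mulr1.
Qed.

Lemma mixed_traceS b a :
  mixed_trace b.+1 a = mixed_trace b a.+1 - mixed_sum b a.
Proof.
rewrite /mixed_trace /mixed_sum (exprSr _ b) (exprS _ a) -!mulmxE.
rewrite mulmxBr mulmxBl raddfB /= mulmxA; congr (_ - _).
rewrite {2}ones_mul_tr !mulmxA -[_ *m N ^+ a]mulmxA mxtrace_mulC !mulmxA.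
by rewrite /mxtrace big_ord1.
Qed.

End Moments.

Section MomentsAgree.
Variables (R : numDomainType) (n n' : nat) (e : rel 'I_n) (e' : rel 'I_n').
Hypotheses (eqv_e : equivalence_rel e) (eqv_e' : equivalence_rel e').

(** [mixed_sum b a] is the moment of order [a + b] plus a polynomial in lower
    moments. *)
Lemma mixed_sum_diff b a :
  (forall j, (j < a + b)%N -> moment R e j = moment R e' j) ->
  mixed_sum R e b a - mixed_sum R e' b a =
  moment R e (a + b) - moment R e' (a + b).
Proof.
elim: b a => [|b IHb] a eq_mom; first by rewrite !mixed_sum0 // addn0.
rewrite !mixed_sumS // (eq_mom a) ?addnS ?ltnS ?leq_addr //.
have eq0 : mixed_sum R e b 0 = mixed_sum R e' b 0.
  apply/eqP; rewrite -subr_eq0 IHb ?add0n ?eq_mom ?subrr //.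
    by rewrite addnS ltnS leq_addl.
  by move=> j jb; apply: eq_mom; rewrite addnS ltnS ltnW // ltn_addl.
rewrite eq0 opprB addrA subrK IHb ?addSn // => j; rewrite -addnS.
exact: eq_mom.
Qed.

(** Each of the [b] steps from [N ^+ m.+1] to [M ^+ b *m N ^+ a] subtracts one
    copy of the moment of order [m], up to lower moments. *)
Lemma mixed_trace_diff m b a : (a + b = m.+1)%N ->
  (forall j, (j < m)%N -> moment R e j = moment R e' j) ->
  mixed_trace R e b a - mixed_trace R e' b a =
  (1 - b%:R) * (moment R e m - moment R e' m).
Proof.
move=> + eq_mom; elim: b a => [|b IHb] a.
  by rewrite addn0 => ->; rewrite !mixed_trace0 // subr0 mul1r.
rewrite addnS => -[ab]; rewrite !mixed_traceS //.
have T_diff := IHb a.+1 (etrans (addSn a b) (congr1 S ab)).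
have t_diff : mixed_sum R e b a - mixed_sum R e' b a =
              moment R e m - moment R e' m.
  by rewrite mixed_sum_diff ab.
transitivity ((mixed_trace R e b a.+1 - mixed_trace R e' b a.+1) -
              (mixed_sum R e b a - mixed_sum R e' b a)); first by ring.
by rewrite T_diff t_diff -natr1; ring.
Qed.

(** The trace of exponent [m + 1] determines the moment of order [m] through the
    coefficient [- m], which vanishes only for the moment of order 0; that one
    is the size of the matrix. *)
Lemma moments_of_traces : n = n' ->
  (forall r, \tr ((\matrix_(i, j) (e i j)%:R - const_mx 1 : 'M[R]_n) ^+ r) =
             \tr ((\matrix_(i, j) (e' i j)%:R - const_mx 1 : 'M[R]_n') ^+ r)) ->
  forall m, moment R e m = moment R e' m.
Proof.
move=> eq_n eq_tr m; elim/ltn_ind: m => -[|m] IHm.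
  rewrite /moment; under eq_bigr do rewrite expr0.
  under [RHS]eq_bigr do rewrite expr0.
  by rewrite !sumr_const !card_ord eq_n.
have := mixed_trace_diff (add0n m.+2) IHm.
rewrite /mixed_trace !expr0 !mulmx1 eq_tr subrr => /esym/eqP.
rewrite mulf_eq0 !subr_eq0 => /orP[|/eqP//].
by rewrite -[1]/(1%:R) eqr_nat.
Qed.
End MomentsAgree.

(** Equal moments give equal sums of the values of any polynomial; the one that
    vanishes at all occurring values but [m] counts the occurrences of [m]. *)
Lemma count_of_moments (R : numDomainType) (I J : finType)
    (c : I -> nat) (d : J -> nat) :
  (forall a, \sum_i (c i)%:R ^+ a = \sum_j (d j)%:R ^+ a :> R) ->
  forall m, #|[set i | c i == m]| = #|[set j | d j == m]|.
Proof.
move=> eq_mom m.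
have eq_poly (p : {poly R}) : \sum_i p.[(c i)%:R] = \sum_j p.[(d j)%:R].
  under eq_bigr do rewrite horner_coef.
  under [RHS]eq_bigr do rewrite horner_coef.
  rewrite exchange_big [RHS]exchange_big; apply: eq_bigr => k _ /=.
  by rewrite -!mulr_sumr eq_mom.
pose K := (\max_i c i + \max_j d j)%N.
pose p : {poly R} := \prod_(k < K.+1 | k != m :> nat) ('X - (k%:R)%:P).
have p0 k : (k <= K)%N -> k != m -> p.[k%:R] = 0.
  move=> kK km; apply/eqP; rewrite /p horner_prod prodf_seq_eq0.
  apply/hasP; exists (Ordinal (kK : k < K.+1)%N); first exact: mem_index_enum.
  by rewrite /= km hornerXsubC subrr eqxx.
have pm : p.[m%:R] != 0.
  rewrite /p horner_prod prodf_seq_neq0; apply/allP => k _; apply/implyP => km.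
  by rewrite hornerXsubC subr_eq0 eqr_nat eq_sym.
have sum_p (T : finType) (g : T -> nat) : (forall t, (g t <= K)%N) ->
    \sum_t p.[(g t)%:R] = p.[m%:R] *+ #|[set t | g t == m]|.
  move=> gK; rewrite (bigID (fun t => g t == m)) /= [X in _ + X]big1 ?addr0.
    rewrite (eq_bigr (fun=> p.[m%:R])) => [|t /eqP-> //].
    by rewrite sumr_const cardsE.
  by move=> t; apply: p0.
have := eq_poly p; rewrite !sum_p => [|t|t].
- rewrite -[LHS]mulr_natr -[RHS]mulr_natr => /(mulfI pm)/eqP.
  by rewrite eqr_nat => /eqP.
- by rewrite /K (leq_trans (leq_bigmax t)) ?leq_addl.
- by rewrite /K (leq_trans (leq_bigmax t)) ?leq_addr.
Qed.

(** * Matching the classes of two equivalence relations *)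

(** The k-th element of a fibre of [phi] goes to the k-th element of the
    corresponding fibre of [psi]. *)
Lemma fibrewise_injection (X Y : finType) (T : eqType)
    (A : {set X}) (B : {set Y}) (phi : X -> T) (psi : Y -> T) (y0 : Y) :
  (forall x, x \in A ->
     #|[set x' in A | phi x' == phi x]| <=
     #|[set y in B | psi y == phi x]|)%N ->
  exists f : X -> Y, {in A &, injective f} /\
    {in A, forall x, f x \in B /\ psi (f x) = phi x}.
Proof.
move=> le_fib.
pose FA t := [set x in A | phi x == t]; pose FB t := [set y in B | psi y == t].
pose f x := nth y0 (enum (FB (phi x))) (index x (enum (FA (phi x)))).
have lt_index x : x \in A ->
    (index x (enum (FA (phi x))) < size (enum (FB (phi x))))%N.
  move=> Ax; rewrite -cardE (leq_trans _ (le_fib x Ax)) // cardE index_mem.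
  by rewrite mem_enum inE Ax eqxx.
have fP x : x \in A -> f x \in B /\ psi (f x) = phi x.
  move=> Ax; have := mem_nth y0 (lt_index x Ax).
  by rewrite mem_enum inE => /andP[-> /eqP].
exists f; split=> // x x' Ax Ax' eq_f.
have eq_phi : phi x = phi x'.
  by have [_ <-] := fP x Ax; have [_ <-] := fP x' Ax'; rewrite eq_f.
move: eq_f; rewrite /f -eq_phi => /eqP.
rewrite nth_uniq ?enum_uniq ?lt_index //; last by rewrite eq_phi lt_index.
move/eqP; apply: (index_inj x); rewrite mem_enum inE.
  by rewrite Ax eqxx.
by rewrite Ax' eq_phi eqxx.
Qed.

Section Classes.
Variables (X : finType) (e : rel X).
Hypothesis eqv_e : equivalence_rel e.

Lemma eclass_eq x y : (eclass e x == eclass e y) = e x y.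
Proof.
have erefl z : e z z by have [] := eqv_e z z z.
apply/eqP/idP => [/setP/(_ y) | exy]; first by rewrite !inE erefl.
by apply/setP => z; rewrite !inE; have [_ ->] := eqv_e x y z.
Qed.

Lemma card_eclass_preim x :
  #|[set y | eclass e y == eclass e x]| = #|eclass e x|.
Proof. by apply: eq_card => y; rewrite !inE eq_sym eclass_eq. Qed.

Lemma card_eclass_size m :
  #|[set x | #|eclass e x| == m]| =
  (#|[set B in eclass e @: setT | #|B| == m]| * m)%N.
Proof.
rewrite -sum1_card (partition_big (eclass e)
  (fun B => B \in [set B in eclass e @: setT | #|B| == m])) /=; last first.
  by move=> x; rewrite !inE => ->; rewrite andbT imset_f.
rewrite -sum_nat_const; apply: eq_bigr => B.
rewrite inE => /andP[/imsetP[x _ ->] /eqP Bm].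
rewrite -{2}Bm -card_eclass_preim -sum1_card; apply: eq_bigl => y.
rewrite !inE; case: (eclass e y =P eclass e x) => [->|_].
  by rewrite Bm eqxx.
by rewrite andbF.
Qed.
End Classes.

(** The number of elements in classes of size [m] is [m] times the number of
    such classes, so the classes can be matched by their sizes through some [F];
    the elements are then matched by their classes, up to [F].  Both matchings
    come from [fibrewise_injection]. *)
Lemma equivalence_bijection (X Y : finType) (y0 : Y) (e : rel X) (e' : rel Y) :
  equivalence_rel e -> equivalence_rel e' -> #|X| = #|Y| ->
  (forall m, #|[set x | #|eclass e x| == m]| =
             #|[set y | #|eclass e' y| == m]|) ->
  exists2 f : X -> Y, bijective f & forall x x', e' (f x) (f x') = e x x'.
Proof.
move=> eqv_e eqv_e' eq_cardXY eq_count.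
have le_size B : B \in eclass e @: setT ->
    (#|[set B' in eclass e @: setT | #|B'| == #|B|]| <=
     #|[set B' in eclass e' @: setT | #|B'| == #|B|]|)%N.
  case/imsetP => x _ ->; have := eq_count #|eclass e x|.
  rewrite !card_eclass_size // => /eqP; rewrite eqn_pmul2r => [/eqP-> //|].
  by apply/card_gt0P; exists x; rewrite inE; have [] := eqv_e x x x.
have [F [F_inj FP]] := fibrewise_injection set0 le_size.
have le_class x : x \in setT ->
    (#|[set x' in setT | F (eclass e x') == F (eclass e x)]| <=
     #|[set y in setT | eclass e' y == F (eclass e x)]|)%N.
  move=> _; have ex : eclass e x \in eclass e @: setT by apply: imset_f.
  have [/imsetP[y _ Fy] sizeF] := FP _ ex.
  rewrite Fy; apply: eq_leq.
  transitivity #|[set x' | eclass e x' == eclass e x]|.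
    by apply: eq_card => x'; rewrite !inE -Fy (inj_in_eq F_inj) // imset_f //.
  rewrite card_eclass_preim // -sizeF Fy -(card_eclass_preim eqv_e').
  by apply: eq_card => y'; rewrite !inE.
have [f [f_inj fP]] := fibrewise_injection y0 le_class.
have{} f_inj : injective f by move=> x x' /f_inj; apply; rewrite inE.
have fE x : eclass e' (f x) = F (eclass e x) by have [] := fP x (in_setT x).
exists f; first by apply: inj_card_bij f_inj _; rewrite eq_cardXY.
move=> x x'; rewrite -eclass_eq // !fE (inj_in_eq F_inj) ?imset_f //.
exact: eclass_eq.
Qed.

(** * Hermitian adjacency matrices of digraphs *)

Section FromDigraphs.
Variable C : numClosedFieldType.
Local Open Scope sesquilinear_scope.

Lemma size_eigenvalues (n : nat) (A : 'M[C]_n) : size (eigenvalues A) = n.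
Proof.
have := size_char_poly A; rewrite eigenvaluesE size_prod_XsubC.
by case.
Qed.

Lemma fourth_rootP (z : C) :
  reflect (z ^+ 4 = 1) (z \in [:: 1; -1; 'i; - 'i]).
Proof.
apply: (iffP idP) => [|z4].
  rewrite !inE => /or4P[] /eqP->; rewrite ?expr1n //; first by ring.
    by rewrite (exprM _ 2 2) sqrCi; ring.
  by rewrite (exprM _ 2 2) sqrrN sqrCi; ring.
have /eqP : (z - 1) * (z + 1) * (z - 'i) * (z + 'i) = 0.
  transitivity ((z ^+ 2 - 1) * (z ^+ 2 - 'i ^+ 2)); first by ring.
  by rewrite sqrCi; transitivity (z ^+ 4 - 1); [ring | rewrite z4 subrr].
rewrite !mulf_eq0 !subr_eq0 !addr_eq0 !inE -!orbA.
by case/or4P => ->; rewrite ?orbT.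
Qed.

Lemma invmx_diag (n : nat) (t : 'I_n -> C) : (forall i, t i ^+ 4 = 1) ->
  diag_mx (\row_i t i) \in unitmx /\
  invmx (diag_mx (\row_i t i)) = diag_mx (\row_i (t i)^*).
Proof.
move=> t4.
have tt : diag_mx (\row_i (t i)^*) *m diag_mx (\row_i t i) = 1%:M.
  rewrite mul_diag_mx; apply/matrixP => i j; rewrite !mxE.
  by case: eqP => _; rewrite ?mulr0 // mulr1n mulrC fourth_root_conj.
have [_ tu] := mulmx1_unit tt; split=> //.
by rewrite -[invmx _]mul1mx -tt mulmxK.
Qed.

Lemma conj_diag_entry (n : nat) (t : 'I_n -> C) (A : 'M[C]_n) i j :
  (forall i, t i ^+ 4 = 1) ->
  (invmx (diag_mx (\row_i t i)) *m A *m diag_mx (\row_i t i)) i j =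
  (t i)^* * A i j * t j.
Proof.
by move=> /invmx_diag[_ ->]; rewrite mul_mx_diag mul_diag_mx !mxE.
Qed.

Lemma trace_switched n (A : 'M[C]_n) (g : rel 'I_n) (t : 'I_n -> C) r :
  (forall i, t i ^+ 4 = 1) -> A^t* = A ->
  (forall i j, A i j = (t i)^* * ((g i j)%:R - 1) * t j) ->
  \tr ((\matrix_(i, j) (g i j)%:R - const_mx 1 : 'M[C]_n) ^+ r) =
  \sum_(z <- eigenvalues A) z ^+ r.
Proof.
move=> t4 A_herm At; have [tu _] := invmx_diag t4.
rewrite -trace_expr; last by apply/hermitian_normalmx/hermitian_hermsymmx.
set M := _ - _.
have -> : A = invmx (diag_mx (\row_i t i)) *m M *m diag_mx (\row_i t i).
  by apply/matrixP => i j; rewrite conj_diag_entry // At !mxE.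
by rewrite conj_expr // [RHS]mxtrace_mulC mulmxA mulmxV // mul1mx.
Qed.

Section Digraph.
Variables (V : finType) (D : digraph V).
Let H := herm_adj C D.

Lemma herm_entryC (u v : V) : herm_entry C D v u = (herm_entry C D u v)^*.
Proof.
rewrite /herm_entry; case: (D u v); case: (D v u);
by rewrite ?rmorphN /= ?conjCi ?opprK ?rmorph1 ?rmorph0.
Qed.

Lemma herm_adj_herm : H^t* = H.
Proof. by apply/matrixP => i j; rewrite !mxE -herm_entryC. Qed.

Lemma herm_adj_diag i : H i i = 0.
Proof. by rewrite mxE /herm_entry arc_irr. Qed.

Lemma herm_adj_unit i j : H i j != 0 -> H i j ^+ 4 = 1.
Proof.
rewrite mxE /herm_entry; case: (D _ _); case: (D _ _); rewrite ?eqxx // => _;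
by apply/fourth_rootP; rewrite !inE eqxx ?orbT.
Qed.

Lemma herm_entry_neq0 u v : (herm_entry C D u v != 0) = D u v || D v u.
Proof.
rewrite /herm_entry; case: (D u v); case: (D v u);
by rewrite ?oppr_eq0 ?neq0Ci ?oner_eq0 ?eqxx.
Qed.

Lemma herm_adj_row : connected D -> (1 < #|V|)%N ->
  forall i, exists j, H i j != 0.
Proof.
move=> connD V_gt1 i.
have /card_gt0P[y] : (0 < #|predC1 (enum_val i)|)%N.
  by rewrite cardC1; case: #|V| V_gt1 => [|[]].
rewrite !inE eq_sym => ne_y; have /connectP[[|z p] /=] := connD (enum_val i) y.
  by move=> _ eq_y; rewrite eq_y eqxx in ne_y.
move=> /andP[iz _] _; exists (enum_rank z).
by rewrite mxE enum_rankK herm_entry_neq0.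
Qed.

Hypotheses (connD : connected D) (rankD : \rank H = 4%N)
  (negD : count (fun z : C => z < 0) (spectrum C D) = 1%N).

(** The form of [canonical_form] in which the underlying graph enters through
    the nonadjacency relation: [H] is conjugate to [N - J]. *)
Lemma digraph_structure :
  equivalence_rel (fun i j => H i j == 0) /\
  exists2 s : 'I_#|V| -> C, (forall i, s i ^+ 4 = 1) &
    forall i j, H i j = (s i)^* * ((H i j == 0)%:R - 1) * s j.
Proof.
have rank_gt2 : (2 < \rank H)%N by rewrite rankD.
have V_gt1 : (1 < #|V|)%N.
  by apply: leq_trans (rank_leq_row H); rewrite rankD.
have H_row := herm_adj_row connD V_gt1; split.
  move=> i j k; split=> [|/eqP ij]; first by rewrite herm_adj_diag eqxx.
  exact: (nonadjacent_eq0 herm_adj_herm negD herm_adj_diag herm_adj_unit H_row).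
have [s [s4 Hs]] := canonical_form herm_adj_herm negD herm_adj_diag
  herm_adj_unit H_row rank_gt2.
exists s => // i j; rewrite {1}Hs.
by case: eqP => _ /=; ring.
Qed.
End Digraph.

End FromDigraphs.

Theorem proposition6p4 (C : numClosedFieldType) (V W : finType)
    (D : digraph V) (D' : digraph W)
    (connD : connected D) (connD' : connected D')
    (rankD : \rank (herm_adj C D) = 4%N) (rankD' : \rank (herm_adj C D') = 4%N)
    (negD : count (fun z : C => z < 0) (spectrum C D) = 1%N)
    (negD' : count (fun z : C => z < 0) (spectrum C D') = 1%N)
    (cosp : cospectral C D D') :
  switching_equivalent C D D'.
Proof.
have [eqv_e [s s4 Hs]] := digraph_structure connD rankD negD.
have [eqv_e' [s' s4' Hs']] := digraph_structure connD' rankD' negD'.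
set H := herm_adj C D in eqv_e Hs; set H' := herm_adj C D' in eqv_e' Hs'.
set e := fun i j => H i j == 0 in eqv_e.
set e' := fun i j => H' i j == 0 in eqv_e'.
have eq_n : #|V| = #|W|.
  by rewrite -(size_eigenvalues H) -(size_eigenvalues H') (perm_size cosp).
have eq_moment m : moment C e m = moment C e' m.
  apply: moments_of_traces => // r.
  rewrite (trace_switched (g := e) r s4 (herm_adj_herm C D) Hs)
    (trace_switched (g := e') r s4' (herm_adj_herm C D') Hs').
  exact: perm_big.
have j0 : 'I_#|W|.
  by apply: (@Ordinal _ 0); apply: leq_trans (rank_leq_row H'); rewrite rankD'.
have [f f_bij fP] := @equivalence_bijection _ _ j0 e e' eqv_e eqv_e'
  (etrans (card_ord _) (etrans eq_n (esym (card_ord _))))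
  (count_of_moments eq_moment).
pose g (x : V) : W := enum_val (f (enum_rank x)).
have irr1 : irreflexive (fun x y => D' (g x) (g y)) by move=> x; apply: arc_irr.
pose D1 : digraph V := Digraph irr1.
have g_bij : bijective g.
  apply: bij_comp; first exact: enum_val_bij.
  exact: bij_comp f_bij (enum_rank_bij _).
exists D1; last by left; exists g.
(* back from [N - J] to [H] through [s], then on to the matrix of [D'] *)
pose t i := (s i)^* * s' (f i).
have t4 i : t i ^+ 4 = 1 by rewrite exprMn -rmorphXn s4 s4' rmorph1 mulr1.
exists (diag_mx (\row_i t i)); split.
- exact: diag_mx_is_diag.
- by move=> i; apply/fourth_rootP; rewrite !mxE eqxx mulr1n.
apply/matrixP => i j; rewrite conj_diag_entry // -/H.
have -> : herm_adj C D1 i j = H' (f i) (f j).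
  by rewrite !mxE /herm_entry /= /g !enum_valK.
have -> : t j = (s j)^* * s' (f j) by [].
rewrite Hs' Hs -/(e i j) -/(e' (f i) (f j)) fP /t rmorphM /= conjCK.
transitivity ((s' (f i))^* * ((e i j)%:R - 1) * s' (f j) *
   (s i * (s i)^* ) * (s j * (s j)^* )); last by ring.
by rewrite !fourth_root_conj // !mulr1.
Qed.
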